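(* A magma $(S,\cdot)$ is a homogroup with a unique idempotent which is a bi-identity if and only if there exist a class group $(\mathcal{G},\bullet)$ and a choice function $\varphi:\mathcal{G}\to\bigcup\mathcal{G}$ such that $S=\bigcup\mathcal{G}$ and $\cdot=\bullet^{\varphi}$, where $x\bullet^{\varphi}y:=\varphi(A_x\bullet A_y)$ for $x,y\in\bigcup\mathcal{G}$, and $A_x$, $A_y$ denote those elements of $\mathcal{G}$ that contain $x$, $y$ respectively.
   Context: A magma is a set with a single binary operation. A homogroup is a semigroup containing an ideal subgroup, i.e. a (two-sided) ideal that is a group under the restricted operation. An element $e$ of $(S,\cdot)$ is a bi-identity if $exy=xy=xye$ for all $x,y\in S$. A class group is a group $(\mathcal{G},\bullet)$ whose elements are nonempty, pairwise disjoint sets; a choice function is a map $\varphi:\mathcal{G}\to\bigcup\mathcal{G}$ with $\varphi(A)\in A$ for every $A\in\mathcal{G}$. *)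

(* Defs.v *)
From mathcomp Require Import all_boot.
From mathcomp Require Import boolp classical_sets.

Set Implicit Arguments.
Unset Strict Implicit.
Unset Printing Implicit Defensive.

Local Open Scope classical_set_scope.
Local Open Scope group_scope.

(* op is total on T, but only its restriction to A is constrained. *)
Definition group_on (T : Type) (A : set T) (op : T -> T -> T) : Prop :=
  [/\ forall x y, A x -> A y -> A (op x y),
      forall x y z, A x -> A y -> A z -> op x (op y z) = op (op x y) z &
      exists e, [/\ A e,
        forall x, A x -> op e x = x /\ op x e = x &
        forall x, A x -> exists y, [/\ A y, op x y = e & op y x = e]]].

Definition two_sided_ideal (S : magmaType) (I : set S) : Prop :=
  I !=set0 /\ forall s x : S, I x -> I (s * x) /\ I (x * s).

Definition homogroup (S : magmaType) : Prop :=
  associative (@mul S) /\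
  exists I : set S, two_sided_ideal I /\ group_on I (@mul S).

Definition idempotent_elt (S : magmaType) (e : S) : Prop := e * e = e.

(* In a semigroup the bracketing is immaterial; it only matters for a bare
   magma, where products are read from left to right. *)
Definition bi_identity (S : magmaType) (e : S) : Prop :=
  forall x y : S, e * x * y = x * y /\ x * y = x * y * e.

Definition class_group (T : Type) (G : set (set T))
    (bullet : set T -> set T -> set T) : Prop :=
  [/\ group_on G bullet, forall A, G A -> A !=set0 & trivIset G id].

(* phi is total on sets, but only its values on G matter. *)
Definition choice_function (T : Type) (G : set (set T)) (phi : set T -> T) :
    Prop :=
  forall A, G A -> A (phi A).

(* The member of G containing x: unique when the members of G are pairwise
   disjoint; the default set0 is returned only when there is none. *)
Definition class_of (T : Type) (G : set (set T)) (x : T) : set T :=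
  xget set0 [set A | G A /\ A x].

Definition choice_op (T : Type) (G : set (set T))
    (bullet : set T -> set T -> set T) (phi : set T -> T) (x y : T) : T :=
  phi (bullet (class_of G x) (class_of G y)).

(* Main.v *)
(** In a homogroup whose only idempotent [e] is a bi-identity, [e] is the
    neutral element of the ideal subgroup [I], the map [x |-> x * e] is a
    retraction onto [I], and [x * y = (x * e) * (y * e)]. The class group thus
    consists of the fibres of this retraction, multiplied as elements of [I],
    and the choice function picks the point of [I] in each fibre. Conversely, a
    choice operation is constant on classes, and [phi] carries the class group
    isomorphically onto the ideal of all products. *)
Require Import Defs.
From mathcomp Require Import all_boot.
From mathcomp Require Import boolp classical_sets.

Local Open Scope classical_set_scope.

(** Serves both directions: with [f] the fibre map, it carries the ideal subgroup to the class
    group; with [f] the choice function, it goes back. *)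
Lemma group_on_image {T U : Type} {A : set T} {op : T -> T -> T}
    {op' : U -> U -> U} {f : T -> U} :
  (forall x y, A x -> A y -> op' (f x) (f y) = f (op x y)) ->
  group_on A op -> group_on (f @` A) op'.
Proof.
move=> fM [opA opassoc [e [Ae op1 opV]]]; split.
- move=> _ _ [x Ax <-] [y Ay <-].
  by exists (op x y); [exact: opA | rewrite fM].
- move=> _ _ _ [x Ax <-] [y Ay <-] [z Az <-].
  by rewrite !fM ?opassoc //; exact: opA.
- exists (f e); split; first by exists e.
  + by move=> _ [x Ax <-]; have [ex xe] := op1 x Ax; rewrite !fM // ex xe.
  + move=> _ [x Ax <-]; have [y [Ay xy yx]] := opV x Ax.
    by exists (f y); split; [exists y | rewrite fM // xy | rewrite fM // yx].
Qed.

(** Multiplying [op z z = z] by an inverse of [z] leaves only the identity. *)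
Lemma group_on_idempotent {T : Type} {A : set T} {op : T -> T -> T} {e x : T} :
  group_on A op -> A e -> A x -> op e e = e -> op x x = x -> x = e.
Proof.
move=> [opA opassoc [u [Au op1 opV]]].
have idem_u z : A z -> op z z = z -> z = u.
  move=> Az zz; have [w [Aw zw _]] := opV z Az.
  by rewrite -zw -{2}zz -opassoc // zw (op1 z Az).2.
by move=> Ae Ax /(idem_u e Ae) -> /(idem_u x Ax) ->.
Qed.

Lemma class_of_eq {T : Type} {G : set (set T)} {A : set T} {x : T} :
  trivIset G id -> G A -> A x -> class_of G x = A.
Proof.
move=> tG GA Ax; apply: xget_unique => // B [GB Bx].
by apply: tG => //; exists x.
Qed.

Section HomogroupToClassGroup.
Variables (S : magmaType) (e : S) (I : set S).
Hypotheses (mulA : associative (@mul S)) (idealI : two_sided_ideal I).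
Hypotheses (groupI : group_on I (@mul S)).
Hypotheses (uniq_e : unique (@idempotent_elt S) e) (bi_e : bi_identity e).

Let fibre (i : S) : set S := [set x | mul x e = i].
(** Right multiplication by [e] sends all points of a fibre to the same element, so the value does
    not depend on the point that [xget] returns; its default [e] is met only on the empty set. *)
Let pick (A : set S) : S := mul (xget (e : {classic S}) A) e.

(** The identity of [I] is idempotent, hence equal to [e]. *)
Lemma ideal_neutral : I e /\ forall x, I x -> mul e x = x /\ mul x e = x.
Proof.
have [_ _ [u [Iu mul1 _]]] := groupI.
by have -> : e = u by apply: (proj2 uniq_e); exact: (mul1 u Iu).1.
Qed.

Lemma mulr_ideal (x : S) : I (mul x e).
Proof. exact: (idealI.2 x e ideal_neutral.1).1. Qed.

(** The inner [e] is absorbed by [y * e], which lies in [I]; the outer one by the bi-identity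
    law. *)
Lemma mul_retract (x y : S) : mul (mul x e) (mul y e) = mul x y.
Proof.
have [_ mul1] := ideal_neutral.
by rewrite -mulA (mul1 _ (mulr_ideal y)).1 mulA -(bi_e x y).2.
Qed.

Lemma fibreK (i : S) : I i -> pick (fibre i) = i.
Proof.
move=> Ii; rewrite /pick; case: xgetP => [x _ //|/(_ i)].
by case; exact: (ideal_neutral.2 i Ii).2.
Qed.

Lemma homogroup_class_group :
  exists (G : set (set S)) (bullet : set S -> set S -> set S)
         (phi : set S -> S),
    [/\ class_group G bullet,
        choice_function G phi,
        [set: S] = \bigcup_(A in G) A &
        @mul S =2 choice_op G bullet phi].
Proof.
pose bullet A B := fibre (mul (pick A) (pick B)).
have fibreM i j : I i -> I j -> bullet (fibre i) (fibre j) = fibre (mul i j).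
  by move=> Ii Ij; rewrite /bullet !fibreK.
have tG : trivIset (fibre @` I) id.
  by move=> _ _ [i _ <-] [j _ <-] [x [/= <- <-]].
have Gx x : (fibre @` I) (fibre (mul x e)).
  by exists (mul x e) => //; exact: mulr_ideal.
exists (fibre @` I), bullet, pick; split.
- split=> //; first exact: group_on_image fibreM groupI.
  by move=> _ [i Ii <-]; exists i; exact: (ideal_neutral.2 i Ii).2.
- move=> _ [i Ii <-]; rewrite fibreK //.
  exact: (ideal_neutral.2 i Ii).2.
- by apply/seteqP; split=> // x _; exists (fibre (mul x e)).
- move=> x y; rewrite /choice_op.
  rewrite (class_of_eq tG (Gx x) erefl) (class_of_eq tG (Gx y) erefl).
  rewrite fibreM ?fibreK ?mul_retract //; try exact: mulr_ideal.
  (* Every product lies in [I], being equal to [x * y * e]. *)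
  by rewrite (bi_e x y).2; exact: mulr_ideal.
Qed.

End HomogroupToClassGroup.

Section ClassGroupToHomogroup.
Variables (S : magmaType) (G : set (set S)).
Variables (bullet : set S -> set S -> set S) (phi : set S -> S).
Hypotheses (classG : class_group G bullet) (choiceG : choice_function G phi).
Hypotheses (coverG : [set: S] = \bigcup_(A in G) A).
Hypothesis mulE : @mul S =2 choice_op G bullet phi.

Let cls : S -> set S := class_of G.

Lemma class_of_in (x : S) : G (cls x).
Proof.
have [_ _ tG] := classG.
have [A GA Ax] : (\bigcup_(A in G) A) x by rewrite -coverG.
by rewrite /cls (class_of_eq tG GA Ax).
Qed.

Lemma class_of_choice (A : set S) : G A -> cls (phi A) = A.
Proof.
by have [_ _ tG] := classG => GA; apply: class_of_eq => //; exact: choiceG.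
Qed.

(** A chosen point lies in its own class, so [cls] is a homomorphism to the class group. *)
Lemma class_of_mul (x y : S) : cls (mul x y) = bullet (cls x) (cls y).
Proof.
have [[GM _ _] _ _] := classG.
by rewrite mulE class_of_choice //; apply: GM; exact: class_of_in.
Qed.

Lemma class_group_homogroup :
  homogroup S /\ exists e : S, unique (@idempotent_elt S) e /\ bi_identity e.
Proof.
have [groupG _ _] := classG.
have [GM bulletA [E [GE G1 _]]] := groupG.
have mulcls x y : mul x y = phi (bullet (cls x) (cls y)) := mulE x y.
have Gc := class_of_in.
have mulI x y : (phi @` G) (mul x y).
  by exists (bullet (cls x) (cls y)); [exact: GM | rewrite mulcls].
split.
  split.
    (* Both bracketings are [phi] of a triple product of classes. *)
    move=> x y z; rewrite !(mulcls _ (mul _ _)) !(mulcls (mul _ _)).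
    by rewrite !class_of_mul bulletA.
  exists (phi @` G); split.
    by split=> [|s x _]; [exists (phi E), E | split; exact: mulI].
  apply: group_on_image groupG => A B GA GB.
  by rewrite mulcls !class_of_choice.
have clsE : cls (phi E) = E by exact: class_of_choice.
exists (phi E); split; first split.
- by rewrite /idempotent_elt mulcls clsE (G1 E GE).1.
(* An idempotent [x = x * x] is [phi (cls x)], and [cls x] is an idempotent of the class group,
   hence [E]. *)
- move=> x xx; rewrite -xx mulcls -class_of_mul xx; congr phi.
  apply/esym/(group_on_idempotent groupG) => //; first exact: (G1 E GE).1.
  by rewrite -class_of_mul xx.
(* A product depends only on the classes of its factors, and [E] is neutral among these. *)
- move=> x y; have Gxy := GM _ _ (Gc x) (Gc y).
  split; first by rewrite mulcls class_of_mul clsE (G1 _ (Gc x)).1 -mulcls.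
  by rewrite (mulcls (mul x y)) class_of_mul clsE (G1 _ Gxy).2 -mulcls.
Qed.

End ClassGroupToHomogroup.

Theorem theorem1p1 (S : magmaType) :
  (homogroup S /\
   exists e : S, unique (@idempotent_elt S) e /\ bi_identity e)
  <->
  (exists (G : set (set S)) (bullet : set S -> set S -> set S)
          (phi : set S -> S),
     [/\ class_group G bullet,
         choice_function G phi,
         [set: S] = \bigcup_(A in G) A &
         @mul S =2 choice_op G bullet phi]).
Proof.
split=> [[[mulA [I [idealI groupI]]] [e [uniq_e bi_e]]]|].
  exact: (homogroup_class_group _ e I).
move=> [G [bullet [phi [classG choiceG coverG mulE]]]].
exact: (class_group_homogroup _ G bullet phi).
Qed.
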